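(* Let $r\ge2$, $t\ge1$ be integers and $a\in(3/2,2]$. For every $\beta>0$ there exist $\gamma>0$ and $n_0$ such that for all $n\ge n_0$, if $G$ is an $n$-vertex $T_{r+1}^t$-free digraph satisfying $e_a(G)\ge a\,t_r(n)-\gamma n^2$, then $G$ can be turned into $\mathrm{DT}_r(n)$ by changing (adding or deleting) at most $\beta n^2$ arcs.
   Context: A digraph is a set of vertices with a set of ordered pairs of distinct vertices (arcs). For a digraph $G$, $f_1(G)$ is the number of unordered pairs $\{u,v\}$ such that exactly one of $uv,vu$ is an arc, and $f_2(G)$ the number of unordered pairs with both $uv,vu$ arcs; for real $a\ge1$, $e_a(G)=a f_2(G)+f_1(G)$. $t_r(n)$ is the number of edges of the $r$-partite Turán graph $\mathrm{Tu}_r(n)$ on $n$ vertices (complete $r$-partite, parts as equal as possible), and $\mathrm{DT}_r(n)$ is the digraph obtained from $\mathrm{Tu}_r(n)$ by replacing each edge by a pair of opposite arcs. $T_{r+1}^t$ is obtained from the transitive tournament $T_{r+1}$ by replacing each vertex by an independent set of size $t$ and adding all arcs from the $i$-th set to the $j$-th set whenever $ij$ is an arc of $T_{r+1}$; $H$-free means containing no copy of $H$ as a subdigraph. *)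

(* Defs.v *)
From mathcomp Require Import all_boot all_order all_algebra reals.

Set Implicit Arguments.
Unset Strict Implicit.
Unset Printing Implicit Defensive.

Import Order.TTheory GRing.Theory Num.Theory.

Record sgraph (V : finType) := SGraph {
  edge :> rel V;
  edge_sym : symmetric edge;
  edge_irr : irreflexive edge }.

(* Unordered pairs are represented by the sets [set u; v]. *)
Definition num_edges (V : finType) (G : sgraph V) : nat :=
  #|[set [set u; v] | u in V, v in V & edge G u v]|.

Record digraph (V : finType) := Digraph {
  arc :> rel V;
  arc_irr : irreflexive arc }.

(* Only pairs with u != v contribute, both here and in f2, where it follows
   from irreflexivity. *)
Definition f1 (V : finType) (G : digraph V) : nat :=
  #|[set [set u; v] | u in V, v in V & arc G u v (+) arc G v u]|.

Definition f2 (V : finType) (G : digraph V) : nat :=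
  #|[set [set u; v] | u in V, v in V & arc G u v && arc G v u]|.

Definition weighted_size (R : realType) (a : R) (V : finType)
    (G : digraph V) : R :=
  (a * (f2 G)%:R + (f1 G)%:R)%R.

(* The parts are the residue classes modulo r, hence r parts (some empty when
   n < r) whose sizes differ by at most one. *)
Definition turan_rel (r n : nat) : rel 'I_n := fun i j => i %% r != j %% r.

Lemma turan_sym r n : symmetric (@turan_rel r n).
Proof. by move=> i j; rewrite /turan_rel eq_sym. Qed.

Lemma turan_irr r n : irreflexive (@turan_rel r n).
Proof. by move=> i; rewrite /turan_rel eqxx. Qed.

Definition turan_graph (r n : nat) : sgraph 'I_n :=
  SGraph (@turan_sym r n) (@turan_irr r n).

Definition turan_number (r n : nat) : nat := num_edges (turan_graph r n).

Definition bidirected (V : finType) (G : sgraph V) : digraph V :=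
  Digraph (edge_irr G).

Definition DT (r n : nat) : digraph 'I_n := bidirected (turan_graph r n).

Lemma trans_tournament_irr k : irreflexive (fun i j : 'I_k => i < j).
Proof. by move=> i; rewrite ltnn. Qed.

Definition trans_tournament (k : nat) : digraph 'I_k :=
  Digraph (@trans_tournament_irr k).

Lemma blowup_irr (V : finType) (G : digraph V) t :
  irreflexive (fun x y : V * 'I_t => arc G x.1 y.1).
Proof. by move=> x; rewrite arc_irr. Qed.

Definition blowup (V : finType) (G : digraph V) (t : nat) :
  digraph (V * 'I_t)%type := Digraph (@blowup_irr V G t).

(* Containment as a not necessarily induced subdigraph. *)
Definition contains_copy (W V : finType) (H : digraph W) (G : digraph V) :
    Prop :=
  exists f : W -> V,
    injective f /\ forall x y : W, arc H x y -> arc G (f x) (f y).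

Definition free_of (W V : finType) (H : digraph W) (G : digraph V) : Prop :=
  ~ contains_copy H G.

Definition isomorphic (W V : finType) (H : digraph W) (G : digraph V) : Prop :=
  exists f : W -> V,
    bijective f /\ forall x y : W, arc H x y = arc G (f x) (f y).

(* Number of arcs to add to or delete from G in order to obtain G'. *)
Definition num_changes (V : finType) (G G' : digraph V) : nat :=
  #|[set p : V * V | arc G p.1 p.2 != arc G' p.1 p.2]|.

(* Main.v *)
(** Call a k-tuple transitive if each of its entries sends arcs to all later
    ones.  By the usual supersaturation argument, a digraph without the blow-up
    of the transitive tournament has only few transitive (r+1)-tuples, and this
    can be exploited without regularity or removal lemmas.

    Upper bound for a = 3/2.  In a digraph with no transitive (r+1)-tuple, order
    the vertices at random and keep a vertex if its predecessors all lie in its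
    out-neighbourhood, or all in its in-neighbourhood.  The kept vertices form a
    transitive tournament, so the expected number of kept vertices is at most r;
    this Caro-Wei type inequality amounts to 4 f1 + 6 f2 <= 3 (1 - 1/r) n^2.
    Sampling a bounded number of vertices extends it, up to o(n^2), to digraphs
    with few transitive (r+1)-tuples.

    Stability for a = 2.  Induction on r, following Erdos: take a vertex of
    maximum semidegree, colour its (out- or in-) neighbourhood N by induction, and
    give the rest a new colour.  Counting the arcs with an end outside N gives
    arcs + monochromatic arcs <= (1 - 1/r) n^2 + o(n^2).

    As e_a is a convex combination of e_(3/2) and e_2 with positive weight on
    e_2, a nearly extremal digraph has (1 - 1/r) n^2 - o(n^2) arcs.  The colouring
    above then has few monochromatic arcs, its classes are nearly balanced and
    almost all arcs between different classes are present. *)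

Require Import Defs.
From mathcomp Require Import all_boot all_order all_fingroup all_algebra reals.
From mathcomp Require Import zify ring lra.

Set Implicit Arguments.
Unset Strict Implicit.
Unset Printing Implicit Defensive.

Import Order.TTheory GRing.Theory Num.Theory.

(** * Counting transitive tuples *)

Lemma sum_tuple_cons (V : finType) (M : nmodType) k (F : k.+1.-tuple V -> M) :
  (\sum_s F s = \sum_v \sum_(s : k.-tuple V) F [tuple of v :: s])%R.
Proof.
rewrite pair_bigA /= (reindex (fun p : V * k.-tuple V => [tuple of p.1 :: p.2])) //.
exists (fun s => (thead s, [tuple of behead s])) => [[v s]|s] _ /=.
  by congr pair; apply: val_inj.
by rewrite -tuple_eta.
Qed.

Section TransitiveTuples.
Variables (V : finType) (G : rel V).

Definition out_nbrs v := [set w | G v w].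
Definition in_nbrs v := [set w | G w v].

Definition trans_in (A : {set V}) (s : seq V) := pairwise G s && all (mem A) s.

Definition num_trans k (A : {set V}) : nat :=
  \sum_(s : k.-tuple V) trans_in A s.

Lemma num_transS k A :
  num_trans k.+1 A = \sum_(v in A) num_trans k (A :&: out_nbrs v).
Proof.
rewrite /num_trans sum_tuple_cons /= [RHS]big_mkcond; apply: eq_bigr => v _.
rewrite /trans_in /=; case: (v \in A) => /=; last first.
  by rewrite big1 // => s _; rewrite andbF.
apply: eq_bigr => s _; rewrite andbAC andbC.
congr (nat_of_bool (_ && _)).
rewrite -all_predI; apply: eq_all => w /=.
by rewrite !inE andbC.
Qed.

(** Peeling off the first entry, then the last one by induction, and exchanging the two sums moves
    the recursion to the last entry. *)
Lemma num_transS_in k A :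
  num_trans k.+1 A = \sum_(v in A) num_trans k (A :&: in_nbrs v).
Proof.
elim: k A => [|k IHk] A.
  rewrite num_transS; apply: eq_bigr => v _; apply: eq_bigr => s _.
  by rewrite (tuple0 s).
rewrite num_transS.
under eq_bigr do rewrite IHk.
rewrite (exchange_big_dep (mem A)) /=; last by move=> u v _ /setIP[].
apply: eq_bigr => v vA; rewrite num_transS.
apply: eq_big => [u|u _]; first by rewrite !inE vA.
by rewrite setIAC.
Qed.

Lemma num_transW k (A B : {set V}) : A \subset B -> num_trans k A <= num_trans k B.
Proof.
move=> /subsetP sAB; apply: leq_sum => s _; rewrite /trans_in.
case: pairwise => //=; case sA: (all _ s) => //.
by rewrite (sub_all _ sA) // => x /sAB.
Qed.

Definition count_pairs (E : rel V) (A : {set V}) : nat :=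
  \sum_(u in A) \sum_(v in A) E u v.

Lemma num_trans2 A : num_trans 2 A = count_pairs G A.
Proof.
rewrite num_transS; apply: eq_bigr => u uA.
rewrite num_transS [RHS]big_mkcond [LHS]big_mkcond; apply: eq_bigr => v _.
rewrite !inE; case: (v \in A) => //=; case: (G u v) => //=.
by rewrite /num_trans (big_pred1 [tuple]) // => s; apply/esym/eqP/tuple0.
Qed.

End TransitiveTuples.

Lemma sum_nbrs (V : finType) (E : rel V) (A : {set V}) u :
  \sum_(v in A) E u v = #|A :&: out_nbrs E u|.
Proof.
rewrite -sum1_card [LHS]big_mkcond [RHS]big_mkcond; apply: eq_bigr => v _.
by rewrite !inE; case: (v \in A) => //=; case: E.
Qed.

(** The out- and in-degree sums count each arc inside [A :\: N] twice; the extra term on the left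
    balances this. *)
Lemma count_pairs_split (V : finType) (E : rel V) (A N : {set V}) :
  N \subset A ->
  count_pairs E A + count_pairs E (A :\: N) =
  count_pairs E N + \sum_(u in A :\: N) #|A :&: out_nbrs E u|
                  + \sum_(u in A :\: N) #|A :&: in_nbrs E u|.
Proof.
move=> /setIidPr NA.
have sp (F : V -> nat) :
    \sum_(v in A) F v = \sum_(v in N) F v + \sum_(v in A :\: N) F v.
  by rewrite (big_setID N) NA.
have -> : \sum_(u in A :\: N) #|A :&: out_nbrs E u| =
    \sum_(u in A :\: N) \sum_(v in A) E u v.
  by apply: eq_bigr => u _; rewrite sum_nbrs.
have -> : \sum_(u in A :\: N) #|A :&: in_nbrs E u| =
    \sum_(u in A :\: N) \sum_(v in A) E v u.
  by apply: eq_bigr => u _; rewrite (sum_nbrs (fun x y => E y x)).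
rewrite [X in _ = _ + X]exchange_big /= /count_pairs.
rewrite (sp (fun u => \sum_(v in A) E u v)) (sp (fun u => \sum_(v in A :\: N) E u v)).
have -> : \sum_(u in N) \sum_(v in A) E u v =
    \sum_(u in N) \sum_(v in N) E u v + \sum_(u in N) \sum_(v in A :\: N) E u v.
  by rewrite -big_split; apply: eq_bigr => u _; exact: sp.
lia.
Qed.

Lemma count_pairs_drop (V : finType) (E : rel V) (A N : {set V}) :
  N \subset A ->
  count_pairs E A <= count_pairs E N + 2 * #|A :\: N| * #|V|.
Proof.
move=> /(count_pairs_split E) e.
have bd (F : V -> {set V}) : \sum_(u in A :\: N) #|F u| <= #|A :\: N| * #|V|.
  by rewrite -sum_nat_const; apply: leq_sum => u _; exact: max_card.
have := bd (fun u => A :&: out_nbrs E u); have := bd (fun u => A :&: in_nbrs E u).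
lia.
Qed.

Local Open Scope ring_scope.

(** * Stability for the number of arcs *)

Definition monochromatic (V : finType) (G : rel V) (c : V -> nat) : rel V :=
  fun u v => G u v && (c u == c v).

(** The difference of the two sides is a square over [rho * (rho + 1)]. It vanishes when [d] is the
    degree in a balanced complete (rho + 1)-partite graph on [m] vertices. *)
Lemma turan_step (R : realType) (rho m d : R) : 0 < rho ->
  (1 - rho^-1) * d ^+ 2 + 2 * (m - d) * d <= (1 - (rho + 1)^-1) * m ^+ 2.
Proof.
move=> h; rewrite -subr_ge0.
have -> : (1 - (rho + 1)^-1) * m ^+ 2 - ((1 - rho^-1) * d ^+ 2 + 2 * (m - d) * d)
  = ((rho + 1) * d - rho * m) ^+ 2 / (rho * (rho + 1)).
  by field; apply/andP; split; lra.
by apply: divr_ge0; [exact: sqr_ge0|nra].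
Qed.

(** Markov's inequality. *)
Lemma card_large (R : realType) (V : finType) (A : {set V}) (F : V -> nat) (d M : R) :
  0 < d -> (\sum_(v in A) F v)%:R <= M ->
  #|[set v in A | d < (F v)%:R]|%:R * d <= M.
Proof.
move=> d0; apply: le_trans.
rewrite natr_sum (big_setID [set v in A | d < (F v)%:R]) /= -[X in X <= _]addr0.
apply: lerD; last by apply: sumr_ge0 => ? _; exact: ler0n.
rewrite mulr_natl -sumr_const.
rewrite (_ : A :&: _ = [set v in A | d < (F v)%:R]); last first.
  by apply/setP => v; rewrite !inE; case: (v \in A).
by apply: ler_sum => v; rewrite inE => /andP[_ /ltW].
Qed.

(** The induction passes from [A] to a neighbourhood inside it, while errors stay measured against
    all of [V]; no density is rescaled, however small the neighbourhood. *)
Lemma few_trans_colouring (R : realType) r (e : R) : 0 < e ->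
  exists2 d : R, 0 < d & forall (V : finType) (G : rel V) (A : {set V}),
    (num_trans G r.+2 A)%:R <= d * #|V|%:R ^+ r.+2 ->
    exists2 c : V -> nat, forall v, (c v < r.+1)%N &
      (count_pairs G A + count_pairs (monochromatic G c) A)%:R
        <= (1 - r.+1%:R^-1) * #|A|%:R ^+ 2 + e * #|V|%:R ^+ 2.
Proof.
elim: r e => [|r IHr] e e0.
  exists (e / 2); first lra.
  move=> V G A; rewrite num_trans2 => h; exists (fun=> 0%N) => //.
  have -> : count_pairs (monochromatic G (fun=> 0%N)) A = count_pairs G A.
    by apply: eq_bigr => u _; apply: eq_bigr => v _; rewrite /monochromatic eqxx andbT.
  by rewrite natrD; lra.
have [d0 d0_gt0 {}IHr] := IHr (e / 2) ltac:(lra).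
(* By Markov's inequality at most [e / 16 * n] vertices have too many transitive tuples in their
   out-neighbourhood, and likewise for in-neighbourhoods. Deleting all of these costs
   [e / 4 * n ^+ 2] in each of the two arc counts; the induction hypothesis uses the other half of
   [e]. *)
exists (d0 * (e / 16)); first by rewrite mulr_gt0 //; lra.
move=> V G A hA; set n : R := #|V|%:R.
have [V0|V0] := posnP #|V|.
  have cA (E : rel V) B : count_pairs E B = 0%N.
    by rewrite /count_pairs big1 // => u; have := fintype0 u V0.
  exists (fun=> 0%N) => //; rewrite !cA.
  have -> : #|A| = 0%N by apply/eqP; rewrite -leqn0 -V0 max_card.
  by rewrite /n V0 addn0 expr0n /= !mulr0 addr0.
have n0 : 0 < n by rewrite ltr0n.
pose bad (F : V -> {set V}) := [set v in A | d0 * n ^+ r.+2 < (num_trans G r.+2 (A :&: F v))%:R].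
have badP F : num_trans G r.+3 A = (\sum_(v in A) num_trans G r.+2 (A :&: F v))%N ->
    #|bad F|%:R <= e / 16 * n.
  move=> eF; have dn : 0 < d0 * n ^+ r.+2 by rewrite mulr_gt0 // exprn_gt0.
  rewrite -(ler_pM2r dn); apply: le_trans (card_large dn _) _; first by rewrite -eF; exact: hA.
  by rewrite [n ^+ r.+3]exprS; lra.
have bo := badP _ (num_transS G _ A); have bi := badP _ (num_transS_in G _ A).
set Bo := bad (out_nbrs G) in bo; set Bi := bad (in_nbrs G) in bi.
pose A' := A :\: (Bo :|: Bi).
have sA' : A' \subset A by exact: subsetDl.
have cAA' : #|A :\: A'|%:R <= e / 8 * n.
  have : (#|A :\: A'| <= #|Bo| + #|Bi|)%N.
    apply: leq_trans (leq_card_setU _ _); apply: subset_leq_card.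
    by apply/subsetP => v; rewrite !inE; case: (v \in A); rewrite ?andbT ?andbF ?negbK.
  by rewrite -(ler_nat R) natrD; lra.
have good v : v \in A' -> (num_trans G r.+2 (A' :&: out_nbrs G v))%:R <= d0 * n ^+ r.+2
    /\ (num_trans G r.+2 (A' :&: in_nbrs G v))%:R <= d0 * n ^+ r.+2.
  move=> /setDP[vA]; rewrite inE negb_or !inE vA /= -!leNgt => /andP[h1 h2].
  split; [apply: le_trans h1|apply: le_trans h2];
    by rewrite ler_nat num_transW // setSI.
(* [N] is a largest out- or in-neighbourhood, within [A'], of a vertex of [A'], and empty if [A']
   is. *)
have [N [sN hN dN]] : exists N : {set V}, [/\ N \subset A',
    (num_trans G r.+2 N)%:R <= d0 * n ^+ r.+2 &
    forall u, u \in A' -> (#|A' :&: out_nbrs G u| <= #|N|)%N /\ (#|A' :&: in_nbrs G u| <= #|N|)%N].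
  have [->|[v0 v0A]] := set_0Vmem A'.
    exists set0; split => //; last by move=> u; rewrite inE.
    rewrite num_transS big_set0; apply: mulr_ge0; [exact: ltW|by apply: exprn_ge0; exact: ltW].
  pose f u := maxn #|A' :&: out_nbrs G u| #|A' :&: in_nbrs G u|.
  have [v vA vmax] := arg_maxnP f v0A.
  have hv u : u \in A' -> (#|A' :&: out_nbrs G u| <= f v)%N /\ (#|A' :&: in_nbrs G u| <= f v)%N.
    by move=> /vmax; rewrite {1}/f /= geq_max => /andP.
  have [go gi] := good _ vA.
  move: hv; rewrite /f /maxn; case: ifP => _ hv.
    by exists (A' :&: in_nbrs G v); split => //; exact: subsetIl.
  by exists (A' :&: out_nbrs G v); split => //; exact: subsetIl.
have [c cr hc] := IHr _ _ _ hN.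
pose c' v := if v \in N then c v else r.+1.
exists c'; first by move=> v; rewrite /c'; case: ifP => // _; exact: ltnW (cr v).
have drop (E : rel V) : (count_pairs E A)%:R <= (count_pairs E A')%:R + e / 4 * n ^+ 2.
  apply: (@le_trans _ _ (count_pairs E A' + 2 * #|A :\: A'| * #|V|)%:R).
    by rewrite ler_nat count_pairs_drop.
  by rewrite natrD !natrM -/n; nra.
(* All arcs inside [A' :\: N] become monochromatic; they are exactly the extra term on the left of
   [count_pairs_split]. *)
have mono : count_pairs (monochromatic G c') A' =
    (count_pairs (monochromatic G c) N + count_pairs G (A' :\: N))%N.
  rewrite /count_pairs (big_setID N) /= (setIidPr sN); congr addn; apply: eq_bigr => u.
    move=> uN; rewrite (big_setID N) /= (setIidPr sN) [X in (_ + X)%N]big1 ?addn0.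
      by apply: eq_bigr => v vN; rewrite /monochromatic /c' uN vN.
    move=> v /setDP[_ vN]; rewrite /monochromatic /c' uN (negbTE vN).
    by rewrite (ltn_eqF (cr u)) andbF.
  move=> /setDP[_ uN]; rewrite (big_setID N) /= (setIidPr sN) [X in (X + _)%N]big1 ?add0n.
    by apply: eq_bigr => v /setDP[_ vN]; rewrite /monochromatic /c' (negbTE uN) (negbTE vN) eqxx andbT.
  move=> v vN; rewrite /monochromatic /c' (negbTE uN) vN.
  by rewrite (gtn_eqF (cr v)) andbF.
have split := count_pairs_split G sN.
have bd (F : V -> {set V}) : (forall u, u \in A' -> #|A' :&: F u| <= #|N|)%N ->
    (\sum_(u in A' :\: N) #|A' :&: F u| <= #|A' :\: N| * #|N|)%N.
  by move=> h; rewrite -sum_nat_const; apply: leq_sum => u /setDP[/h].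
have so := bd (out_nbrs G) (fun u h => (dN u h).1).
have si := bd (in_nbrs G) (fun u h => (dN u h).2).
have tot : (count_pairs G A' + count_pairs (monochromatic G c') A' <=
  count_pairs G N + count_pairs (monochromatic G c) N + 2 * (#|A' :\: N| * #|N|))%N by lia.
have cN : #|A' :\: N|%:R = #|A'|%:R - #|N|%:R :> R.
  by rewrite cardsD (setIidPr sN) natrB // subset_leq_card.
move: tot; rewrite -(ler_nat R) [in X in _ <= X]natrD !natrM cN => tot.
have ts := @turan_step R r.+1%:R #|A'|%:R #|N|%:R (ltr0Sn _ _).
have : (#|A'|%:R : R) ^+ 2 <= #|A|%:R ^+ 2.
  by rewrite ler_pXn2r ?nnegrE // ler_nat subset_leq_card.
have : 0 <= 1 - (r.+1%:R + 1)^-1 :> R.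
  rewrite subr_ge0 invf_le1; last by rewrite ltr_wpDl.
  by rewrite lerDr.
rewrite -[r.+2%:R]natr1.
have := drop G; have := drop (monochromatic G c'); move: tot hc.
rewrite !natrD -/n.
set q : R := 1 - (_ + 1)^-1 in ts *.
move=> t1 t2 t3 t4 q0 t5; have t6 := ler_wpM2l q0 t5.
apply: le_trans (lerD t4 t3) _.
have {}t6 : q * #|A'|%:R ^+ 2 + e * n ^+ 2 <= q * #|A|%:R ^+ 2 + e * n ^+ 2 by rewrite lerD2r.
apply: le_trans t6.
have {}ts : (1 - r.+1%:R^-1) * #|N|%:R ^+ 2 + 2 * (#|A'|%:R - #|N|%:R) * #|N|%:R + e * n ^+ 2 <= q * #|A'|%:R ^+ 2 + e * n ^+ 2 by rewrite lerD2r.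
apply: le_trans ts.
move: t1 t2.
move: (_ * _ ^+ 2) => x1.
move: (n ^+ 2) => x3.
move: (#|A'|%:R) (#|N|%:R : R) ((count_pairs _ _)%:R) => x4 x5 x6.
lra.
Qed.

(** * Supersaturation *)

Lemma leq_exp_ffact n t : ((n - t) ^ t <= n ^_ t)%N.
Proof.
elim: t n => [|t IHt] n //; rewrite ffactnS expnS leq_mul ?leq_subr //.
by have -> : (n - t.+1 = n.-1 - t)%N by lia.
Qed.

Section ExtendLeft.
Variables (V : finType) (G : rel V) (A : {set V}).

Definition left_exts (s : seq V) := [set v in A | all (G v) s].
Definition right_exts (s : seq V) := [set w in A | all (G^~ w) s].

Lemma num_transS_exts k :
  num_trans G k.+1 A = (\sum_(s : k.-tuple V) trans_in G A s * #|left_exts s|)%N.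
Proof.
rewrite num_transS big_mkcond.
rewrite (eq_bigr (fun v => \sum_(s : k.-tuple V) trans_in G A s * (v \in left_exts s)))%N.
  rewrite exchange_big; apply: eq_bigr => s _; rewrite -big_distrr /=.
  by congr muln; rewrite -sum1_card [RHS]big_mkcond; apply: eq_bigr => v _; case: ifP.
move=> v _; case: (boolP (v \in A)) => vA; last first.
  by rewrite big1 // => s _; rewrite inE (negbTE vA) muln0.
apply: eq_bigr => s _; rewrite /trans_in inE vA mulnb -andbA; congr (nat_of_bool (_ && _)).
by rewrite -all_predI; apply: eq_all => w /=; rewrite !inE.
Qed.

(** Double counting of the pairs [(s, p)] in which every entry of [s] sends arcs to every entry of
    [p]. *)
Lemma sum_num_trans_right_exts k t :
  (\sum_(s in [set s : t.-tuple V | all (mem A) s & uniq s]) num_trans G k (right_exts s)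
   = \sum_(p : k.-tuple V) trans_in G A p * #|left_exts p| ^_ t)%N.
Proof.
rewrite exchange_big; apply: eq_bigr => p _.
rewrite -card_uniq_tuples -sum1_card big_distrr /= [LHS]big_mkcond [RHS]big_mkcond.
apply: eq_bigr => s _; rewrite !inE; case: (uniq s); rewrite ?andbF // !andbT.
have -> : all [in left_exts p] s = all (mem A) s && allrel G s p.
  by rewrite -all_predI; apply: eq_all => w /=; rewrite !inE.
rewrite muln1; case: (all (mem A) s) => //=; rewrite [trans_in G A p]/trans_in.
have -> : trans_in G (right_exts s) p = pairwise G p && (all (mem A) p && allrel G s p).
  rewrite allrelC -all_predI; congr andb; apply: eq_all => w /=; by rewrite !inE.
by rewrite andbA; case: (allrel G s p); rewrite ?andbT ?andbF.
Qed.

End ExtendLeft.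

(** Induction on [k]: by averaging, some [t]-tuple [s] of distinct vertices dominates many
    transitive [k]-tuples. It serves as the first class, and the other classes are found inside
    [right_exts G A s]. *)
Lemma many_trans_blowup (R : realType) k t (d : R) : 0 < d ->
  exists n0 : nat, forall (V : finType) (G : rel V) (A : {set V}), (n0 <= #|V|)%N ->
    d * #|V|%:R ^+ k <= (num_trans G k A)%:R ->
    exists2 Xs : seq (t.-tuple V), size Xs = k &
      all (fun X : t.-tuple V => uniq X && all (mem A) X) Xs
      && pairwise (fun X Y : t.-tuple V => allrel G X Y) Xs.
Proof.
elim: k d => [|k IHk] d d0; first by exists 0%N => V G A _ _; exists [::].
have d40 : 0 < d / 4 by lra.
(* The averaging would give [d / 2] as first factor; [d / 4] makes the contradiction below
   strict. *)
have [n0 {}IHk] := IHk (d / 4 * (d / 4) ^+ t) ltac:(by rewrite mulr_gt0 // exprn_gt0).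
(* This forces [t <= d / 4 * n], so [d / 2 * n] left extensions contain at least [(d / 4 * n) ^+ t]
   tuples with distinct entries. *)
exists (maxn n0 (Num.bound (t%:R / (d / 4))).+1) => V G A; rewrite geq_max => /andP[n0V tV] hA.
set n : R := #|V|%:R in hA *.
have n_gt0 : 0 < n by rewrite ltr0n; apply: leq_ltn_trans tV.
have tn : t%:R <= d / 4 * n.
  rewrite mulrC -ler_pdivrMr //.
  have /archi_boundP h : 0 <= t%:R / (d / 4) by rewrite divr_ge0 // ltW.
  by apply: ltW (lt_trans h _); rewrite ltr_nat.
pose good (p : k.-tuple V) := trans_in G A p && (d / 2 * n <= #|left_exts G A p|%:R).
pose g : R := \sum_(p : k.-tuple V) (good p)%:R.
have cg : d / 2 * n ^+ k <= g.
  have : (num_trans G k.+1 A)%:R <= \sum_(p : k.-tuple V) ((good p)%:R * n + d / 2 * n).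
    rewrite num_transS_exts natr_sum; apply: ler_sum => p _; rewrite natrM /good.
    have : #|left_exts G A p|%:R <= n by rewrite ler_nat max_card.
    have : 0 <= d / 2 * n by rewrite mulr_ge0 // ltW //; lra.
    case: trans_in; rewrite /= ?mul1r ?mul0r ?add0r //.
    by case: (lerP (d / 2 * n)) => /=; rewrite ?mul1r ?mul0r ?add0r; lra.
  rewrite big_split /= -mulr_suml -/g sumr_const card_tuple -[X in _ + X]mulr_natl natrX -/n => h.
  rewrite -(ler_pM2r n_gt0).
  by have := le_trans hA h; rewrite exprS; lra.
have low : g * (d / 4 * n) ^+ t <= 
   (\sum_(s in [set s : t.-tuple V | all (mem A) s & uniq s]) num_trans G k (right_exts G A s))%:R.
  rewrite sum_num_trans_right_exts natr_sum mulr_suml; apply: ler_sum => p _.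
  rewrite natrM /good; case: trans_in; rewrite ?mul0r //= mul1r.
  case: (lerP (d / 2 * n)) => h; rewrite ?mul0r // mul1r.
  apply: (@le_trans _ _ ((#|left_exts G A p| - t) ^ t)%N%:R); last first.
    by rewrite ler_nat leq_exp_ffact.
  rewrite natrX; apply: lerXn2r; rewrite ?nnegrE ?ler0n //.
    by rewrite mulr_ge0 // ltW.
  rewrite natrB; first by lra.
  have dn : 0 < d / 4 * n by rewrite mulr_gt0.
  by rewrite -(ler_nat R); lra.
have [s sA hs] : exists2 s : t.-tuple V, s \in [set s : t.-tuple V | all (mem A) s & uniq s]
    & d / 4 * (d / 4) ^+ t * n ^+ k <= (num_trans G k (right_exts G A s))%:R.
  apply/exists_inP; apply: contraT => /exists_inPn H; exfalso.
  have : (\sum_(s in [set s : t.-tuple V | all (mem A) s & uniq s]) num_trans G k (right_exts G A s))%:R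
     <= n ^+ t * (d / 4 * (d / 4) ^+ t * n ^+ k).
    rewrite natr_sum; apply: (@le_trans _ _ (\sum_(s : t.-tuple V) (d / 4 * (d / 4) ^+ t * n ^+ k))).
      rewrite big_mkcond; apply: ler_sum => s _; case: ifP => [/H|_].
        by rewrite -ltNge => /ltW.
      by apply: mulr_ge0; [apply: mulr_ge0|]; rewrite ?exprn_ge0 ?(ltW d40) ?(ltW n_gt0).
    by rewrite sumr_const card_tuple -[X in X <= _]mulr_natl natrX.
  apply/negP; rewrite -ltNge; apply: lt_le_trans low.
  rewrite [(d / 4 * n) ^+ t]exprMn.
  have q1 : 0 < (d / 4) ^+ t by rewrite exprn_gt0.
  have q2 : 0 < n ^+ t by rewrite exprn_gt0.
  have q3 : 0 < n ^+ k by rewrite exprn_gt0.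
  have q : 0 < (d / 4) ^+ t * n ^+ t by rewrite mulr_gt0.
  have -> : n ^+ t * (d / 4 * (d / 4) ^+ t * n ^+ k) = (d / 4 * n ^+ k) * ((d / 4) ^+ t * n ^+ t) by ring.
  by rewrite ltr_pM2r //; nra.
have [Xs sXs /andP[aXs pXs]] := IHk V G _ n0V hs.
exists (s :: Xs) => /=; first by rewrite sXs.
move: sA; rewrite inE => /andP[-> ->] /=; rewrite pXs andbT.
apply/andP; split.
  apply: sub_all aXs => X /andP[-> /=]; apply: sub_all => w; rewrite !inE.
  by case/andP.
apply: sub_all aXs => X /andP[_ h]; rewrite allrelC; apply: sub_all h => w.
by rewrite !inE => /andP[].
Qed.

(** * A Caro-Wei inequality *)

Section CaroWei.
Variables (R : realType) (T : finType) (G : rel T).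

(** In a random ordering of [A], the inverse of [#|A :&: K|.+1] is the probability that [u] precedes
    all of [A :&: K]. The identity conditions on the last vertex [v]; for [v = u] the event requires
    [A :&: K] to be empty. *)
Lemma sum_first_prob (A K : {set T}) u : u \in A -> u \notin K ->
  \sum_(v in A | v != u) (#|(A :\ v) :&: K|.+1%:R)^-1 + (A :&: K == set0)%:R
  = #|A|%:R / #|A :&: K|.+1%:R :> R.
Proof.
move=> uA uK.
rewrite (bigID (mem K)) /=.
(* If [A :&: K] is empty, the quotient is 0 / 0 = 0, and the indicator supplies the missing 1. *)
have -> : \sum_(v | ((v \in A) && (v != u)) && (v \in K)) (#|(A :\ v) :&: K|.+1%:R)^-1
    = #|A :&: K|%:R / #|A :&: K|%:R :> R.
  rewrite (eq_bigl (mem (A :&: K))); last first.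
    move=> v; rewrite !inE; case: (boolP (v \in K)) => vK; rewrite ?andbF // !andbT.
    by rewrite (contraNneq _ uK) ?andbT // => <-.
  rewrite mulr_natl -sumr_const; apply: eq_bigr => v vAK.
  have -> : (A :\ v) :&: K = (A :&: K) :\ v by rewrite setIDAC.
  have {}vAK : v \in A :&: K := vAK.
  by rewrite [in RHS](cardsD1 v) vAK.
have -> : \sum_(v | ((v \in A) && (v != u)) && (v \notin K)) (#|(A :\ v) :&: K|.+1%:R)^-1
    = (#|A|%:R - #|A :&: K|.+1%:R) / #|A :&: K|.+1%:R :> R.
  rewrite (eq_bigl (mem ((A :\: K) :\ u))); last first.
    by move=> v; rewrite !inE; case: (v \in A); case: (v \in K); case: (v == u).
  have -> : #|A|%:R - #|A :&: K|.+1%:R = #|(A :\: K) :\ u|%:R :> R.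
    rewrite -(cardsID K A) (cardsD1 u (A :\: K)) inE uA uK /= -[#|A :&: K|.+1]addn1 !natrD.
    by rewrite opprD addrACA subrr add0r addrAC subrr add0r.
  rewrite mulr_natl -sumr_const; apply: eq_bigr => v; rewrite !inE => /and3P[_ vK _].
  have -> // : (A :\ v) :&: K = A :&: K.
  by apply/setP => w; rewrite !inE; case: eqP => // ->; rewrite (negbTE vK) !andbF.
rewrite -cards_eq0; case: #|A :&: K| => [|k] /=.
  by rewrite mul0r divr1 divr1; lra.
rewrite divff ?pnatr_eq0 // -[k.+2%:R]natr1.
have : (0 : R) <= k.+1%:R by rewrite ler0n.
by move: (k.+1%:R) => y y0; field; lra.
Qed.

Definition not_out u := [set w | w != u & ~~ G u w].
Definition not_in u := [set w | w != u & ~~ G w u].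
(** No predecessor of [u] lies in this union exactly when both events of [end_prob] occur, whence
    the inclusion-exclusion there. *)
Definition not_double u := not_out u :|: not_in u.

(* The probability that, in a random ordering of A, the elements of A preceding
   u all lie in the out-neighbourhood of u or all lie in its in-neighbourhood. *)
Definition end_prob (A : {set T}) u : R :=
  (#|A :&: not_out u|.+1%:R)^-1 + (#|A :&: not_in u|.+1%:R)^-1
  - (#|A :&: not_double u|.+1%:R)^-1.

(** The random ordering is derandomised from its end. Averaging yields a last vertex [v] such that
    the sum for [A :\ v] plus [ok v], the indicator that [v] is kept, is at least the sum for [A]. A
    kept vertex is put at the front or at the back of the sequence. *)
Lemma trans_seq_end_prob (A : {set T}) :
  exists s : seq T, [/\ pairwise G s, all (mem A) s &
    \sum_(u in A) end_prob A u <= (size s)%:R].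
Proof.
have [n] := ubnP #|A|; elim: n A => // n IHn A; rewrite ltnS => cA.
have [->|[x xA]] := set_0Vmem A; first by exists [::]; rewrite big_set0.
pose ok v : R := (A :&: not_out v == set0)%:R + (A :&: not_in v == set0)%:R
   - (A :&: not_double v == set0)%:R.
pose S := \sum_(u in A) end_prob A u.
have avg : \sum_(v in A) (\sum_(u in A :\ v) end_prob (A :\ v) u + ok v) = \sum_(v in A) S.
  rewrite big_split /= (exchange_big_dep (mem A)) /=; last by move=> ? ? _ /setD1P[].
  rewrite sumr_const -mulr_natl mulr_sumr -big_split; apply: eq_bigr => u uA.
  rewrite (eq_bigl (fun v => (v \in A) && (v != u))); last first.
    by move=> v; rewrite !inE eq_sym uA andbT.
  rewrite /end_prob !big_split /= sumrN /ok.
  have h1 := @sum_first_prob A (not_out u) u uA _.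
  have h2 := @sum_first_prob A (not_in u) u uA _.
  have h3 := @sum_first_prob A (not_double u) u uA _.
  rewrite !inE eqxx /= in h1 h2 h3.
  by rewrite mulrBr mulrDr -h1 // -h2 // -h3 //; lra.
have [v vA hv] : exists2 v, v \in A & S <= \sum_(u in A :\ v) end_prob (A :\ v) u + ok v.
  apply/exists_inP; apply: contraT => /exists_inPn H; exfalso.
  suff : \sum_(v in A) (\sum_(u in A :\ v) end_prob (A :\ v) u + ok v) < \sum_(v in A) S.
    by rewrite avg ltxx.
  apply: ltr_sum; first by apply/hasP; exists x; rewrite ?mem_index_enum.
  by move=> v /H; rewrite -ltNge.
have [|s [ps sA hs]] := IHn (A :\ v).
  by apply: leq_trans cA; rewrite [in X in (_ < X)%N](cardsD1 v) vA.
have sA' : all (mem A) s by apply: sub_all sA => w /setD1P[].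
have nb (F : T -> {set T}) (P : pred T) : (forall w, (w \in F v) = (w != v) && ~~ P w) ->
    A :&: F v = set0 -> all P s.
  move=> hF h; apply/allP => w ws; have /setD1P[wv wA] := allP sA _ ws.
  by move/setP/(_ w): h; rewrite !inE wA hF wv /=; case: (P w).
have [e1|e1] := eqVneq (A :&: not_out v) set0.
  exists (v :: s); split => /=; [|by rewrite vA|].
    by rewrite ps andbT; apply: (nb not_out) => // w; rewrite inE.
  apply: le_trans hv _; rewrite -natr1; apply: lerD => //.
  by rewrite /ok e1 eqxx /not_double setIUr e1 set0U addrK.
have [e2|e2] := eqVneq (A :&: not_in v) set0.
  exists (rcons s v); split; rewrite ?all_rcons /= ?vA //.
    rewrite pairwise_rcons ps andbT; apply: (nb not_in) => // w; by rewrite inE.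
  rewrite size_rcons; apply: le_trans hv _; rewrite -natr1; apply: lerD => //.
  by rewrite /ok e2 eqxx (negbTE e1) add0r gerBl ler0n.
exists s; split => //; apply: le_trans hv _; rewrite -[leRHS]addr0; apply: lerD => //.
by rewrite /ok (negbTE e1) (negbTE e2) addr0 sub0r oppr_le0 ler0n.
Qed.

(* Here [c] is free: the tangent to [1 / q] at [q = 1 / c] makes the lower bound
   linear in [q = 2 x + 2 y - z], so that it can be summed over the vertices. *)
Lemma end_prob_bound (x y z : R) : 1 <= x -> 1 <= y -> x <= z -> y <= z -> z <= x + y ->
  forall c : R, 0 < c -> 3 * (2 * c - (2 * x + 2 * y - z) * c ^+ 2) <= x^-1 + y^-1 - z^-1.
Proof.
move=> x1 y1 xz yz zxy c c0.
set q := 2 * x + 2 * y - z.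
have q0 : 0 < q by rewrite /q; lra.
apply: (@le_trans _ _ (3 / q)).
  rewrite ler_pM2l // -subr_ge0.
  have -> : q^-1 - (2 * c - q * c ^+ 2) = (1 - q * c) ^+ 2 / q by field; lra.
  by rewrite divr_ge0 ?sqr_ge0 // ltW.
(* The harmonic mean inequality reduces the claim to the case [x = y]; the remaining difference
   factors, with signs given by [x + y <= 2 * z] and [z <= x + y]. *)
apply: (@le_trans _ _ (4 / (x + y) - z^-1)).
  rewrite -subr_ge0.
  have -> : 4 / (x + y) - z^-1 - 3 / q
     = 2 * ((2 * z - (x + y)) * (x + y - z)) / ((x + y) * z * q).
    by rewrite /q; field; rewrite /q in q0; apply/and3P; split; lra.
  apply: divr_ge0; last by rewrite !mulr_ge0 //; lra.
  by rewrite mulr_ge0 // mulr_ge0 //; lra.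
rewrite lerD2r -subr_ge0.
have -> : x^-1 + y^-1 - 4 / (x + y) = (x - y) ^+ 2 / (x * y * (x + y)).
  by field; apply/and3P; split; lra.
by apply: divr_ge0; rewrite ?sqr_ge0 // !mulr_ge0 //; lra.
Qed.

(* Summed over ordered pairs this gives 4 f1 + 6 f2, that is 4 e_(3/2). *)
Definition pair_weight u w : nat := 2 * (G u w || G w u) + (G u w && G w u).

Lemma pair_weight_le u w : (pair_weight u w <= 3)%N.
Proof. by rewrite /pair_weight; case: (G u w); case: (G w u). Qed.

Hypothesis Girr : irreflexive G.

(** The successor counts [u] itself, which fails [P]. *)
Lemma card_not_nbrs u (P : pred T) : ~~ P u ->
  #|[set w | w != u & ~~ P w]|.+1%:R = \sum_w (1 - (P w)%:R) :> R.
Proof.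
move=> Pu.
have -> : #|[set w | w != u & ~~ P w]|.+1 = #|[set w | ~~ P w]|.
  rewrite (cardsD1 u [set w | ~~ P w]) inE Pu; congr (_.+1); apply: eq_card => w.
  by rewrite !inE.
rewrite -sum1_card natr_sum big_mkcond; apply: eq_bigr => w _.
by rewrite inE; case: (P w); rewrite /= ?subrr ?subr0.
Qed.

Lemma sum_pair_weight_le r : (0 < r)%N -> (forall s, pairwise G s -> size s <= r)%N ->
  \sum_u \sum_w (pair_weight u w)%:R <= 3 * (1 - r%:R^-1) * #|T|%:R ^+ 2 :> R.
Proof.
move=> r0 hr; set m : R := #|T|%:R.
have [T0|T0] := posnP #|T|.
  rewrite big1 => [|u _]; last by have := fintype0 u T0.
  by rewrite /m T0 expr0n mulr0.
have m0 : 0 < m by rewrite ltr0n.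
have [s [/hr sr _ hs]] := trans_seq_end_prob setT.
pose x u : R := #|not_out u|.+1%:R; pose y u : R := #|not_in u|.+1%:R.
pose z u : R := #|not_double u|.+1%:R.
(* The tangent point: if the claimed bound is attained, [2 x + 2 y - z] has mean [3 * m / r]. *)
have c0 : 0 < r%:R / (3 * m) by rewrite divr_gt0 ?ltr0n // mulr_gt0.
have q u : 2 * x u + 2 * y u - z u = 3 * m - \sum_w (pair_weight u w)%:R.
  rewrite /x /y /z card_not_nbrs ?Girr // (card_not_nbrs (P := G^~ u)) ?Girr //.
  have -> : not_double u = [set w | w != u & ~~ (G u w && G w u)].
    by apply/setP => w; rewrite !inE; case: eqP => //=; case: (G u w); case: (G w u).
  rewrite card_not_nbrs ?Girr //.
  rewrite /m -sum1_card natr_sum !mulr_sumr -big_split -!sumrB.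
  apply: eq_bigr => w _; rewrite /pair_weight.
  by case: (G u w); case: (G w u); rewrite /=; lra.
have bound u : 3 * (2 * (r%:R / (3 * m)) - (3 * m - \sum_w (pair_weight u w)%:R) * (r%:R / (3 * m)) ^+ 2)
    <= end_prob setT u.
  rewrite -q /end_prob !setTI.
  have c3 : (#|not_double u| <= #|not_out u| + #|not_in u|)%N by exact: leq_card_setU.
  have c1 : (#|not_out u| <= #|not_double u|)%N by rewrite subset_leq_card ?subsetUl.
  have c2 : (#|not_in u| <= #|not_double u|)%N by rewrite subset_leq_card ?subsetUr.
  apply: end_prob_bound; rewrite ?ler1n ?ler_nat //.
  by rewrite -natrD ler_nat; lia.
have : \sum_u 3 * (2 * (r%:R / (3 * m)) - (3 * m - \sum_w (pair_weight u w)%:R) * (r%:R / (3 * m)) ^+ 2)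
    <= r%:R :> R.
  apply: (@le_trans _ _ (\sum_(u in setT) end_prob setT u)).
    by rewrite [leRHS]big_mkcond; apply: ler_sum => u _; rewrite inE; exact: bound.
  by apply: le_trans hs _; rewrite ler_nat.
rewrite -mulr_sumr sumrB sumr_const -mulr_suml sumrB sumr_const.
rewrite -[X in 3 * (X - _)]mulr_natl -[X in (X - _) * _]mulr_natl -/m.
have : (0 : R) < r%:R by rewrite ltr0n.
move: (\sum_u _) (r%:R : R) => W k k0 h.
suff : 0 <= 3 * (k ^+ 2 / (3 * m) ^+ 2) * (3 * (1 - k^-1) * m ^+ 2 - W).
  by rewrite pmulr_rge0 ?subr_ge0 // !mulr_gt0 // invr_gt0 exprn_gt0 // mulr_gt0.
rewrite -subr_ge0 in h; apply: le_trans h _; rewrite le_eqVlt; apply/orP; left; apply/eqP.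
by field; apply/andP; split; lra.
Qed.

End CaroWei.

(** Prescribing [f] at the [k] distinct entries of [i] leaves [m - k] values free. *)
Lemma sum_ffun_tuple (V : finType) m k (i : k.-tuple 'I_m) (F : k.-tuple V -> nat) :
  uniq i ->
  (\sum_(f : {ffun 'I_m -> V}) F (map_tuple f i) = #|V| ^ (m - k) * \sum_p F p)%N.
Proof.
move=> ui; rewrite (partition_big (fun f : {ffun 'I_m -> V} => map_tuple f i) xpredT) //.
rewrite big_distrr; apply: eq_bigr => p _.
rewrite (eq_bigr (fun=> F p)); last by move=> f /eqP ->.
rewrite (eq_bigl (fun f => f \in [set f : {ffun 'I_m -> V} | map_tuple f i == p])); last first.
  by move=> f; rewrite inE.
rewrite sum_nat_const; congr muln.
case: k i ui p F => [|k] i ui p _.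
  have t0 (q q' : 0.-tuple V) : q = q' by rewrite [q]tuple0 [q']tuple0.
  rewrite (eq_card (B := predT)); last by move=> f; rewrite inE (t0 (map_tuple f i) p) eqxx.
  by rewrite card_ffun card_ord subn0.
pose B x : pred V := if x \in i then pred1 (nth (thead p) p (index x i)) else predT.
rewrite (eq_card (B := family B)); last first.
  move=> f; rewrite inE; apply/eqP/familyP => [e x|h].
    rewrite /B -e; case: ifP => // xi; rewrite inE (nth_map x) ?index_mem // nth_index //.
  apply/eq_from_tnth => j; rewrite tnth_map; have := h (tnth i j).
  rewrite /B mem_tnth inE => /eqP ->.
  rewrite [in index _ _](tnth_nth (tnth i j)) index_uniq ?size_tuple //.
  by rewrite -tnth_nth.
rewrite card_family foldrE big_map big_enum /=.
rewrite (bigID (mem i)) /= big1 ?mul1n => [|x xi]; last by rewrite /B xi card1.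
rewrite (eq_bigr (fun=> #|V|)); last by move=> x /negbTE xi; rewrite /B xi cardT.
rewrite prod_nat_const; congr expn.
have := cardC (mem i); rewrite card_ord (card_uniqP ui) size_tuple => e.
rewrite -[X in (X - _)%N]e addKn.
by apply: eq_card.
Qed.

(** * Sampling *)

Section Sampling.
Variables (V : finType) (G : rel V).
Hypothesis Girr : irreflexive G.

(** Samples are drawn with repetition: [f] need not be injective, and it induces the digraph
    [relpre f G] on ['I_m]. *)
Definition sample_trans r m (f : {ffun 'I_m -> V}) : nat :=
  \sum_(i : r.-tuple 'I_m) (uniq i && pairwise G (map_tuple f i)).

Lemma sum_sample_pair_weight m :
  (\sum_(f : {ffun 'I_m -> V}) \sum_i \sum_j pair_weight G (f i) (f j)
   = m * m.-1 * #|V| ^ (m - 2) * \sum_u \sum_w pair_weight G u w)%N.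
Proof.
pose F (p : 2.-tuple V) := pair_weight G (thead p) (thead (behead_tuple p)).
have sF : (\sum_p F p = \sum_u \sum_w pair_weight G u w)%N.
  rewrite sum_tuple_cons; apply: eq_bigr => u _.
  rewrite sum_tuple_cons; apply: eq_bigr => w _.
  by rewrite (big_pred1 [tuple]) // => s; apply/esym/eqP/tuple0.
rewrite exchange_big /=.
transitivity (\sum_(i < m) m.-1 * (#|V| ^ (m - 2) * \sum_u \sum_w pair_weight G u w))%N; last first.
  by rewrite sum_nat_const card_ord !mulnA.
apply: eq_bigr => i _; rewrite exchange_big (bigD1 i) //= big1 => [|f _]; last first.
  by rewrite /pair_weight Girr.
transitivity (\sum_(j < m | j != i) #|V| ^ (m - 2) * \sum_u \sum_w pair_weight G u w)%N; last first.
  by rewrite sum_nat_const cardC1 card_ord.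
rewrite add0n.
apply: eq_bigr => j ji; rewrite -sF.
rewrite -(@sum_ffun_tuple V m 2 [tuple i; j] F) //=.
by rewrite inE eq_sym ji.
Qed.

Lemma sum_sample_trans r m :
  (\sum_(f : {ffun 'I_m -> V}) sample_trans r f
   <= m ^ r * (#|V| ^ (m - r) * num_trans G r [set: V]))%N.
Proof.
rewrite exchange_big.
apply: (@leq_trans (\sum_(i : r.-tuple 'I_m) #|V| ^ (m - r) * num_trans G r [set: V])); last first.
  by rewrite sum_nat_const card_tuple card_ord.
apply: leq_sum => i _; case: (boolP (uniq i)) => /= ui; last by rewrite big1.
rewrite (sum_ffun_tuple (fun p => nat_of_bool (pairwise G p)) ui) leq_mul2l; apply/orP; right.
apply: leq_sum => p _; rewrite /trans_in.
have -> : all (mem [set: V]) p by apply/allP => x _; rewrite inE.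
by rewrite andbT.
Qed.

(** If the sample has no transitive (r+1)-tuple, the Caro-Wei inequality applies to the induced
    digraph. Otherwise the trivial bound of 3 per pair is absorbed by the last term. *)
Lemma sample_pair_weight_le (R : realType) r m (f : {ffun 'I_m -> V}) : (0 < r)%N ->
  (\sum_i \sum_j pair_weight G (f i) (f j))%N%:R
    <= 3 * (1 - r%:R^-1) * m%:R ^+ 2 + 3 * m%:R ^+ 2 * (sample_trans r.+1 f)%:R :> R.
Proof.
move=> r0.
have m2 : 0 <= m%:R ^+ 2 :> R by rewrite sqr_ge0.
have r1 : 0 <= 1 - r%:R^-1 :> R.
  by rewrite subr_ge0 invf_le1 ?ltr0n // ler1n.
have [e|ne] := posnP (sample_trans r.+1 f).
  rewrite e mulr0 addr0 -[m in leRHS]card_ord.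
  have irr : irreflexive (relpre f G) by move=> i; exact: Girr.
  have := @sum_pair_weight_le R _ (relpre f G) irr r r0.
  rewrite natr_sum => h; under eq_bigr do rewrite natr_sum; apply: h => s ps.
  rewrite leqNgt; apply/negP => rs.
  have st : size (take r.+1 s) == r.+1 by rewrite size_takel.
  have pt : pairwise (relpre f G) (take r.+1 s).
    by move: ps; rewrite -{1}(cat_take_drop r.+1 s) pairwise_cat => /and3P[].
  move/eqP: e; rewrite sum_nat_eq0 => /forallP/(_ (Tuple st)) /=.
  by rewrite pairwise_map pt (pairwise_uniq irr pt).
apply: (@le_trans _ _ (3 * m%:R ^+ 2)); last first.
  have : 1 <= (sample_trans r.+1 f)%:R :> R by rewrite ler1n.
  rewrite -[1 <= _]subr_ge0 => x1.
  by have := mulr_ge0 r1 m2; have := mulr_ge0 m2 x1; lra.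
rewrite -natrX -natrM ler_nat.
apply: (@leq_trans (\sum_(i < m) \sum_(j < m) 3)).
  by do 2! (apply: leq_sum => ? _); exact: pair_weight_le.
rewrite !sum_nat_const card_ord; lia.
Qed.

End Sampling.

Lemma few_trans_pair_weight (R : realType) r (e : R) : (0 < r)%N -> 0 < e ->
  exists2 d : R, 0 < d & forall (V : finType) (G : rel V), irreflexive G ->
    (num_trans G r.+1 [set: V])%:R <= d * #|V|%:R ^+ r.+1 ->
    (\sum_u \sum_w pair_weight G u w)%N%:R
      <= (3 * (1 - r%:R^-1) + e) * #|V|%:R ^+ 2.
Proof.
move=> r0 e0.
(* Pairs of equal indices have weight 0, so averaging loses a factor [m / (m - 1)]; this [m] lets
   [e] absorb it. *)
pose m := (r + 2 + Num.bound (6 / e))%N.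
have m0 : 0 < m%:R :> R by rewrite ltr0n /m; lia.
have me : 6 <= e * (m%:R - 1).
  have /archi_boundP h : 0 <= 6 / e by rewrite divr_ge0 // ltW.
  rewrite mulrC -ler_pdivrMr //; apply: (le_trans (ltW h)).
  by rewrite lerBrDr natr1 ler_nat /m; lia.
have mr : 0 < m%:R ^+ r.+1 :> R by rewrite exprn_gt0.
(* Chosen so that transitive tuples add at most [e / 4 * m ^+ 2 * n ^+ m] to the sum over all
   samples. *)
exists (e / (12 * m%:R ^+ r.+1)); first by rewrite divr_gt0 // mulr_gt0.
move=> V G Girr hG; set n : R := #|V|%:R in hG *.
set S := (\sum_u \sum_w pair_weight G u w)%N.
have [V0|V0] := posnP #|V|.
  rewrite /S big1 => [|u _]; last by have := fintype0 u V0.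
  by rewrite /n V0 expr0n mulr0.
have n0 : 0 < n by rewrite ltr0n.
set q : R := 3 * (1 - r%:R^-1).
have tot : m%:R * (m%:R - 1) * n ^+ (m - 2) * S%:R
   <= q * m%:R ^+ 2 * n ^+ m + 3 * m%:R ^+ 2 * (m%:R ^+ r.+1 * (n ^+ (m - r.+1) * (num_trans G r.+1 setT)%:R)).
  have -> : m%:R * (m%:R - 1) * n ^+ (m - 2) * S%:R = (m * m.-1 * #|V| ^ (m - 2) * S)%N%:R.
    have -> : m%:R - 1 = m.-1%:R :> R.
      by rewrite -subn1 natrB // /m; lia.
    by rewrite !natrM natrX.
  rewrite -sum_sample_pair_weight // natr_sum.
  apply: (@le_trans _ _ (\sum_(f : {ffun 'I_m -> V}) (q * m%:R ^+ 2 + 3 * m%:R ^+ 2 * (sample_trans G r.+1 f)%:R))).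
    by apply: ler_sum => f _; exact: sample_pair_weight_le.
  rewrite big_split /= sumr_const card_ffun card_ord -[X in X + _]mulr_natr natrX -/n.
  rewrite lerD2l -mulr_sumr; apply: ler_wpM2l; first by rewrite mulr_ge0 // sqr_ge0.
  rewrite -natr_sum -!natrX -!natrM ler_nat.
  exact: sum_sample_trans.
have nm : n ^+ m = n ^+ (m - 2) * n ^+ 2 by rewrite -exprD subnK // /m; lia.
have err : n ^+ (m - r.+1) * (num_trans G r.+1 setT)%:R <= e / (12 * m%:R ^+ r.+1) * (n ^+ (m - 2) * n ^+ 2).
  rewrite -nm; have -> : n ^+ m = n ^+ (m - r.+1) * n ^+ r.+1 by rewrite -exprD subnK // /m; lia.
  by rewrite mulrCA ler_wpM2l // exprn_ge0 // ltW.
have N2 : 0 < n ^+ (m - 2) by rewrite exprn_gt0.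
move: tot; rewrite nm => tot.
have {err}tot : m%:R * (m%:R - 1) * n ^+ (m - 2) * S%:R
    <= q * m%:R ^+ 2 * (n ^+ (m - 2) * n ^+ 2) + e / 4 * m%:R ^+ 2 * (n ^+ (m - 2) * n ^+ 2).
  apply: le_trans tot _; rewrite lerD2l.
  have -> : e / 4 * m%:R ^+ 2 * (n ^+ (m - 2) * n ^+ 2) = 3 * m%:R ^+ 2 * (m%:R ^+ r.+1 * (e / (12 * m%:R ^+ r.+1) * (n ^+ (m - 2) * n ^+ 2))).
    by field; rewrite gt_eqF.
  rewrite ler_pM2l; last by rewrite mulr_gt0 // exprn_gt0.
  by rewrite ler_pM2l.
have {}tot : (m%:R - 1) * S%:R <= (q + e / 4) * m%:R * n ^+ 2.
  rewrite -(ler_pM2l (mulr_gt0 m0 N2)).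
  by move: tot; congr (_ <= _); ring.
have q3 : q <= 3.
  have : 0 < r%:R^-1 :> R by rewrite invr_gt0 ltr0n.
  by rewrite /q; lra.
have m1 : 0 < m%:R - 1 :> R by rewrite subr_gt0 ltr1n /m; lia.
rewrite -(ler_pM2l m1); apply: le_trans tot _; rewrite [leRHS]mulrA.
apply: ler_wpM2r; first exact: sqr_ge0.
have m2 : 2 <= m%:R :> R by rewrite ler_nat /m; lia.
clearbody q; move: (m%:R) m2 me m0 m1 => x; nra.
Qed.

(** * From colourings to the Turan digraph *)

(** Contrapositive of [many_trans_blowup]. The classes found there are disjoint, since a common
    vertex would carry a loop. *)
Lemma free_of_few_trans (R : realType) k t (d : R) : 0 < d ->
  exists n0 : nat, forall (V : finType) (G : digraph V), (n0 <= #|V|)%N ->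
    free_of (blowup (trans_tournament k) t) G ->
    (num_trans G k [set: V])%:R <= d * #|V|%:R ^+ k.
Proof.
move=> d0; have [n0 hn0] := @many_trans_blowup R k t d d0.
exists n0 => V G nV free; rewrite leNgt; apply/negP => /ltW /(hn0 _ _ _ nV)[Xs /eqP sXs /andP[uXs pXs]].
pose X i := tnth (Tuple sXs) i.
have XG (i j : 'I_k) (x y : 'I_t) : (i < j)%N -> G (tnth (X i) x) (tnth (X j) y).
  move=> ij; have /(pairwiseP (X i)) h := pXs.
  have : allrel G (X i) (X j).
    by rewrite /X !(tnth_nth (X i)); apply: h; rewrite ?inE //= (eqP sXs).
  by move/allrelP; apply; exact: mem_tnth.
apply: free; exists (fun p => tnth (X p.1) p.2); split; last by move=> x y; exact: XG.
move=> [i x] [j y] /= e; have [ij|ji|ij] := ltngtP i j.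
- by have := XG _ _ x y ij; rewrite e arc_irr.
- by have := XG _ _ y x ji; rewrite e arc_irr.
- have eij : i = j by exact: val_inj.
  rewrite -{j ij}eij in e *.
  have /allP/(_ _ (mem_tnth i (Tuple sXs)))/andP[/tuple_uniqP ui _] := uXs.
  by rewrite (ui _ _ e).
Qed.

(** * Unordered pairs and arcs as sums over ordered pairs *)

Lemma card_edge_sets (V : finType) (e : rel V) : symmetric e -> irreflexive e ->
  (2 * #|[set [set u; v] | u in V, v in V & e u v]| = \sum_u \sum_v e u v)%N.
Proof.
move=> es ei.
pose P := [set p : V * V | e p.1 p.2].
have -> : (\sum_u \sum_v e u v = #|P|)%N.
  rewrite pair_bigA -sum1_card [RHS]big_mkcond; apply: eq_bigr => p _.
  by rewrite inE /=; case: (e _ _).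
have -> : [set [set u; v] | u in V, v in V & e u v] = [set [set p.1; p.2] | p in P].
  apply/setP => X; apply/imset2P/imsetP => [[u v _ uv ->]|[[u v] uv ->]].
    by exists (u, v) => //; rewrite inE; move: uv; rewrite inE.
  by exists u v => //; move: uv; rewrite !inE.
(* Each fibre over a set of two vertices consists of its two orderings. *)
rewrite -[RHS]sum1_card (partition_big_imset (fun p : V * V => [set p.1; p.2])) /=.
rewrite mulnC -sum_nat_const; apply: eq_bigr => X /imsetP[[u v]]; rewrite inE /= => uv ->.
have nuv : u != v by apply: contraTneq uv => ->; rewrite ei.
rewrite sum1dep_card; transitivity #|[set (u, v); (v, u)]|.
  by rewrite cards2 xpair_eqE (negbTE nuv).
apply: eq_card => -[x y]; rewrite !inE /= !xpair_eqE; apply/idP/idP.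
  by case/orP => /andP[/eqP-> /eqP->]; rewrite ?eqxx ?uv ?(es v u) ?uv //= setUC.
case/andP => xy /eqP/setP s; have sx := s x; have sy := s y; have su := s u; have sv := s v.
move: sx sy su sv; rewrite !inE !eqxx ?orbT ?orTb /= => /esym/orP[]/eqP-> /esym/orP[]/eqP->;
  rewrite ?eqxx ?orbT //= => h1 h2.
  by move: h2; rewrite orbb eq_sym (negbTE nuv).
by move: h1; rewrite orbb (negbTE nuv).
Qed.


Lemma sum2D (V : finType) (F H : V -> V -> nat) :
  (\sum_u \sum_v (F u v + H u v) = \sum_u \sum_v F u v + \sum_u \sum_v H u v)%N.
Proof. by rewrite -big_split; apply: eq_bigr => u _; rewrite -big_split. Qed.

Lemma sum2M (V : finType) k (F : V -> V -> nat) :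
  (\sum_u \sum_v (k * F u v) = k * \sum_u \sum_v F u v)%N.
Proof. by rewrite big_distrr; apply: eq_bigr => u _; rewrite big_distrr. Qed.

Lemma eq_sum2 (V : finType) (F H : V -> V -> nat) : F =2 H ->
  (\sum_u \sum_v F u v = \sum_u \sum_v H u v)%N.
Proof. by move=> e; apply: eq_bigr => u _; apply: eq_bigr => v _. Qed.

Lemma count_pairsT (V : finType) (e : rel V) :
  count_pairs e [set: V] = (\sum_u \sum_v e u v)%N.
Proof.
by apply: eq_big => [u|u _]; rewrite ?inE //; apply: eq_bigl => v; rewrite inE.
Qed.

Section ArcCounts.
Variables (V : finType) (G : digraph V).

Lemma sum_single_arcs : (\sum_u \sum_v (G u v (+) G v u) = 2 * f1 G)%N.
Proof.
rewrite /f1 (@card_edge_sets V (fun u v => G u v (+) G v u)) //.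
- by move=> u v; rewrite addbC.
- by move=> u; rewrite addbb.
Qed.

Lemma sum_double_arcs : (\sum_u \sum_v (G u v && G v u) = 2 * f2 G)%N.
Proof.
rewrite /f2 (@card_edge_sets V (fun u v => G u v && G v u)) //.
- by move=> u v; rewrite andbC.
- by move=> u; rewrite arc_irr.
Qed.

Lemma sum_arcs : count_pairs G [set: V] = (f1 G + 2 * f2 G)%N.
Proof.
have ex : (\sum_u \sum_v G u v = \sum_u \sum_v G v u)%N by rewrite exchange_big.
have := sum_double_arcs; have := sum_single_arcs; rewrite count_pairsT.
have : (\sum_u \sum_v (G u v + G v u) = \sum_u \sum_v ((G u v (+) G v u) + 2 * (G u v && G v u)))%N.
  by apply: eq_sum2 => u v; case: (G u v); case: (G v u).
rewrite (sum2D (fun u v => nat_of_bool (G u v))) -ex.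
rewrite (sum2D (fun u v => nat_of_bool (G u v (+) G v u))) sum2M; lia.
Qed.

Lemma sum_pair_weight : (\sum_u \sum_v pair_weight G u v = 4 * f1 G + 6 * f2 G)%N.
Proof.
have := sum_double_arcs; have := sum_single_arcs.
have -> : (\sum_u \sum_v pair_weight G u v = \sum_u \sum_v (2 * (G u v (+) G v u) + 3 * (G u v && G v u)))%N.
  by apply: eq_sum2 => u v; rewrite /pair_weight; case: (G u v); case: (G v u).
rewrite sum2D !sum2M; lia.
Qed.

End ArcCounts.

(** * Residue classes and the Turan number *)

Lemma sum_mod_eq_add r k n : (k < r)%N ->
  (\sum_(j < r + n) (j %% r == k) = (\sum_(j < n) (j %% r == k)).+1)%N.
Proof.
move=> kr; rewrite big_split_ord /= -addn1 addnC; congr addn.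
  by apply: eq_bigr => j _; rewrite modnDl.
rewrite (bigD1 (Ordinal kr)) //= modn_small // eqxx big1 // => j jk.
by rewrite modn_small //; move: jk; rewrite -val_eqE /= => /negbTE ->.
Qed.

Lemma sum_mod_eq_bounds r k n : (k < r)%N ->
  (n %/ r <= \sum_(j < n) (j %% r == k) <= (n %/ r).+1)%N.
Proof.
move=> kr; have r0 : (0 < r)%N by exact: leq_ltn_trans kr.
have blocks q s : (\sum_(j < q * r + s) (j %% r == k) = q + \sum_(j < s) (j %% r == k))%N.
  by elim: q => // q IHq; rewrite mulSn -addnA sum_mod_eq_add // IHq.
have := blocks (n %/ r)%N (n %% r)%N; rewrite -divn_eq => ->.
rewrite leq_addr -addn1 leq_add2l /=.
have [h|h] := ltnP k (n %% r); last first.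
  rewrite big1 // => j _; rewrite modn_small; last exact: ltn_trans (ltn_ord j) (ltn_pmod _ r0).
  by rewrite ltn_eqF // (leq_trans (ltn_ord j)).
rewrite (bigD1 (Ordinal h)) //= modn_small // eqxx big1 // => j jk.
rewrite modn_small; last exact: ltn_trans (ltn_ord j) (ltn_pmod _ r0).
by move: jk; rewrite -val_eqE /= => /negbTE ->.
Qed.

(** Every residue class has at most [n / r + 1] elements; the rounding, summed over all vertices, is
    the linear loss. *)
Lemma turan_number_ge (R : realType) r n : (0 < r)%N ->
  (1 - r%:R^-1) * n%:R ^+ 2 - n%:R <= 2 * (turan_number r n)%:R :> R.
Proof.
move=> r0.
have e : (2 * turan_number r n + \sum_(i < n) \sum_(j < n) (j %% r == i %% r) = n * n)%N.
  rewrite /turan_number /num_edges (@card_edge_sets _ (@turan_rel r n)); last exact: turan_irr.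
    rewrite -sum2D -[RHS]muln1 -mulnA; apply: etrans (_ : \sum_(i < n) \sum_(j < n) 1 = _)%N.
      by apply: eq_sum2 => i j; rewrite /turan_rel eq_sym; case: eqP.
    by rewrite !sum_nat_const !card_ord.
  exact: turan_sym.
have h : (\sum_(i < n) \sum_(j < n) (j %% r == i %% r) <= n * (n %/ r).+1)%N.
  rewrite -[X in (X * _)%N]card_ord -sum_nat_const; apply: leq_sum => i _.
  by have /andP[] := @sum_mod_eq_bounds r (i %% r) n (ltn_pmod _ r0).
have q : (n %/ r)%N%:R <= n%:R / r%:R :> R.
  by rewrite ler_pdivlMr ?ltr0n // -natrM ler_nat leq_trunc_div.
have -> : 2 * (turan_number r n)%:R = n%:R * n%:R - (\sum_(i < n) \sum_(j < n) (j %% r == i %% r))%N%:R :> R.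
  by rewrite -[n%:R * n%:R]natrM -e natrD natrM addrK.
move: h; rewrite -(ler_nat R) natrM -natr1 => h.
apply: (@le_trans _ _ (n%:R * n%:R - n%:R * (n%:R / r%:R + 1))).
  by rewrite le_eqVlt; apply/orP; left; apply/eqP; ring.
by rewrite lerD2l lerN2; apply: le_trans h _; rewrite ler_wpM2l // lerD2r.
Qed.

(* A bijection maximizing the number of vertices sent to the residue class
   named by their colour: if a vertex of colour i were misplaced while some slot
   of class i is filled by a vertex of another colour, swapping the two improves it. *)
Lemma aligned_bijection (V : finType) n r (c : V -> 'I_r) : #|V| = n ->
  exists2 g : V -> 'I_n, bijective g &
    forall i : 'I_r, (#|[set v | (c v == i) && (g v %% r != i)]|
      <= #|[set v | c v == i]| - #|[set x : 'I_n | x %% r == i]|)%N.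
Proof.
move=> Vn.
pose e v : 'I_n := cast_ord Vn (enum_rank v).
have be : bijective e.
  exists (fun x => enum_val (cast_ord (esym Vn) x)) => x; rewrite /e ?cast_ordK ?enum_rankK //.
  by rewrite enum_valK cast_ordKV.
pose agree (p : {perm V}) := [set v | e (p v) %% r == c v :> nat]%N.
have [p _ pmax] := @arg_maxnP _ (1%g : {perm V}) xpredT (fun p => #|agree p|) isT.
have bg : bijective (fun v => e (p v)).
  by apply: (bij_comp be); apply: injF_bij; exact: perm_inj.
exists (fun v => e (p v)) => // i.
have [->|[v]] := set_0Vmem [set v | (c v == i) && (e (p v) %% r != i)%N].
  by rewrite cards0.
rewrite inE => /andP[/eqP cv gv].
have full w : (e (p w) %% r)%N = i -> c w = i.
  move=> gw; apply/eqP; apply: contraT => cw.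
  have vw : v != w by apply: contraNneq gv => ->; rewrite gw.
  suff : (#|agree p| < #|agree (tperm v w * p)%g|)%N.
    by move=> h; have := pmax (tperm v w * p)%g isT; rewrite /= leqNgt h.
  apply/proper_card/properP; split.
    apply/subsetP => x; rewrite !inE permM.
    case: tpermP => [->|->|//] /eqP h; rewrite ?gw.
      by move: gv; rewrite h cv eqxx.
    by move: cw; rewrite -val_eqE /= -h gw eqxx.
  exists v; rewrite !inE ?permM ?tpermL ?gw cv ?eqxx //.
(* All slots of class [i] now hold vertices of colour [i], so the misplaced ones are exactly the
   excess. *)
have -> : #|[set x : 'I_n | x %% r == i]%N| = #|[set w | e (p w) %% r == i]%N|.
  rewrite -(on_card_preimset (f := fun v => e (p v))); last exact: onW_bij.
  by apply: eq_card => w; rewrite !inE.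
rewrite -(cardsID [set w | e (p w) %% r == i]%N [set v | c v == i]).
have -> : [set v | c v == i] :&: [set w | e (p w) %% r == i]%N = [set w | e (p w) %% r == i]%N.
  apply/setIidPr/subsetP => w; rewrite !inE => /eqP/full ->; exact: eqxx.
rewrite addKn; apply: subset_leq_card; apply/subsetP => w; rewrite !inE => /andP[-> ->] //.
Qed.

Lemma sum_nat_pairs1 (V : finType) : (\sum_(u : V) \sum_(v : V) 1 = #|V| * #|V|)%N.
Proof. by rewrite !sum_nat_const muln1. Qed.

Lemma sum_sq_classes (V : finType) r (c : V -> 'I_r) :
  (\sum_u \sum_v (c u == c v) = \sum_(i < r) #|[set v | c v == i]| ^ 2)%N.
Proof.
rewrite (partition_big c xpredT) //=; apply: eq_bigr => i _.
rewrite (eq_bigr (fun=> #|[set v | c v == i]|)) => [|u /eqP ->].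
  by rewrite sum_nat_const -mulnn; congr (_ * _)%N; apply: eq_card => v; rewrite !inE.
rewrite -sum1_card [RHS]big_mkcond; apply: eq_bigr => v _.
by rewrite inE eq_sym; case: eqP.
Qed.

(** [G'] is the Turan digraph pulled back along an aligned bijection. Compare both with the complete
    multipartite digraph of [c]. It differs from [G] in the monochromatic arcs and the missing arcs
    between colours, which accounts for all terms but the last. It differs from [G'] only in pairs
    with a misplaced vertex. *)
Lemma close_to_DT (V : finType) (G : digraph V) n r (c : V -> 'I_r) : #|V| = n ->
  exists G' : digraph V, isomorphic (DT r n) G' /\
    (num_changes G G' + count_pairs G [set: V] + \sum_(i < r) #|[set v | c v == i]| ^ 2
     <= 2 * count_pairs (monochromatic G c) [set: V] + n * n
        + 2 * (n * \sum_(i < r) (#|[set v | c v == i]| - n %/ r)))%N.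
Proof.
move=> Vn; have [g [h gK hK] hg] := aligned_bijection c Vn.
have irr : irreflexive (fun u v => turan_rel r (g u) (g v)) by move=> u; exact: turan_irr.
exists (Digraph irr); split.
  exists h; split; first by exists g.
  by move=> x y /=; rewrite !hK.
pose bad v := (g v %% r != c v)%N.
have cbad : (\sum_v bad v <= \sum_(i < r) (#|[set v | c v == i]| - n %/ r))%N.
  rewrite (partition_big c xpredT) //=; apply: leq_sum => i _.
  apply: (@leq_trans #|[set v | (c v == i) && (g v %% r != i)]|%N).
    rewrite -sum1_card [leqRHS]big_mkcond [leqLHS]big_mkcond; apply: leq_sum => v _.
    rewrite inE /bad; case: eqP => // ->; by case: (_ != _).
  apply: leq_trans (hg i) _; apply: leq_sub2l.
  have /andP[] := @sum_mod_eq_bounds r i n (ltn_ord i); move=> /leq_trans h1 _; apply: h1.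
  by rewrite -sum1_card [leqRHS]big_mkcond; apply: leq_sum => j _; rewrite inE; case: eqP.
have -> : num_changes G (Digraph irr) =
    (\sum_u \sum_v (G u v != turan_rel r (g u) (g v)))%N.
  rewrite pair_bigA /num_changes -sum1_card big_mkcond; apply: eq_bigr => p _.
  by rewrite inE /=; case: (_ != _).
have sb1 : (\sum_(u : V) \sum_(v : V) bad u = n * \sum_v bad v)%N.
  by rewrite big_distrr; apply: eq_bigr => u _; rewrite sum_nat_const Vn.
have sb2 : (\sum_(u : V) \sum_v bad v = n * \sum_v bad v)%N.
  by rewrite sum_nat_const Vn.
rewrite -sum_sq_classes !count_pairsT -[in (n * n)%N]Vn -sum_nat_pairs1.
apply: (@leq_trans (2 * (\sum_u \sum_v monochromatic G c u v) + \sum_(u : V) \sum_(v : V) 1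
   + (n * \sum_v bad v + n * \sum_v bad v))%N).
  rewrite -{1}sb1 -sb2 -sum2M -!sum2D; apply: leq_sum => u _; apply: leq_sum => v _.
  rewrite /monochromatic /turan_rel /bad (val_eqE (c u) (c v)).
  have [gu|gu] := eqVneq (g u %% r)%N (c u); have [gv|gv] := eqVneq (g v %% r)%N (c v).
  - by rewrite gu gv val_eqE; case: (G u v); case: (c u == c v).
  - by case: (G u v); case: (c u == c v); case: (_ == _).
  - by case: (G u v); case: (c u == c v); case: (_ == _).
  - by case: (G u v); case: (c u == c v); case: (_ == _).
rewrite leq_add2l; have : (n * \sum_v bad v <= n * \sum_(i < r) (#|[set v | c v == i]| - n %/ r))%N.
  by rewrite leq_mul2l cbad orbT.
lia.
Qed.

Lemma colouring_close_to_DT (R : realType) (r : nat) (beta : R) : (0 < r)%N -> 0 < beta ->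
  exists2 e : R, 0 < e & exists n0 : nat,
  forall n, (n0 <= n)%N -> forall (V : finType) (G : digraph V) (c : V -> 'I_r),
    #|V| = n ->
    (count_pairs G [set: V] + count_pairs (monochromatic G c) [set: V])%:R
      <= (1 - r%:R^-1) * n%:R ^+ 2 + e * n%:R ^+ 2 ->
    (1 - r%:R^-1) * n%:R ^+ 2 - e * n%:R ^+ 2 <= (count_pairs G [set: V])%:R ->
    exists G' : digraph V, isomorphic (DT r n) G' /\
      (num_changes G G')%:R <= beta * n%:R ^+ 2.
Proof.
move=> r0 b0; have r_gt0 : 0 < r%:R :> R by rewrite ltr0n.
(* [eta] bounds the relative excess of a class over [N / r]; the minimum with 1 gives
   [eta ^+ 2 <= eta]. *)
pose eta : R := Num.min 1 (beta / (8 * r%:R)).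
have eta0 : 0 < eta by rewrite lt_min ltr01 divr_gt0 // mulr_gt0.
have eta1 : eta <= 1 by rewrite ge_min lexx.
have etab : eta * (8 * r%:R) <= beta.
  by rewrite -ler_pdivlMr ?mulr_gt0 // ge_min lexx orbT.
(* With this [e] the monochromatic arcs number at most [2 * e * N ^+ 2], and the squared deviations
   of the class sizes sum to at most [3 * e * N ^+ 2 = (eta * N) ^+ 2]. *)
exists (eta ^+ 2 / 3); first by rewrite divr_gt0 // exprn_gt0.
exists (Num.bound (8 * r%:R / beta)).+1 => n hn V G c Vn h1 h2.
set N : R := n%:R in h1 h2 *.
have N0 : 0 < N by rewrite ltr0n; apply: leq_ltn_trans hn.
have hN : 8 * r%:R <= beta * N.
  have /archi_boundP h : 0 <= 8 * r%:R / beta by rewrite divr_ge0 ?mulr_ge0 // ltW.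
  by rewrite [leRHS]mulrC -ler_pdivrMr //; apply: ltW (lt_trans h _); rewrite ltr_nat.
have [G' [iso ch]] := close_to_DT G c Vn; exists G'; split => //.
pose s i : R := #|[set v | c v == i]|%:R.
have ss : \sum_i s i = N.
  rewrite -natr_sum /N -Vn -sum1_card (partition_big c xpredT) //=; congr (_%:R).
  apply: eq_bigr => i _; rewrite -sum1_card [LHS]big_mkcond [RHS]big_mkcond.
  by apply: eq_bigr => v _; rewrite inE.
set Q : R := \sum_i s i ^+ 2.
have var : \sum_i (s i - N / r%:R) ^+ 2 = Q - N ^+ 2 / r%:R.
  have -> : \sum_i (s i - N / r%:R) ^+ 2 = \sum_i (s i ^+ 2 + - (2 * N / r%:R) * s i + N ^+ 2 / r%:R ^+ 2).
    by apply: eq_bigr => i _; field; rewrite gt_eqF.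
  rewrite !big_split /= -mulr_sumr ss sumr_const card_ord -/Q -mulr_natr.
  by field; rewrite gt_eqF.
have QN : N ^+ 2 / r%:R <= Q.
  by rewrite -subr_ge0 -var; apply: sumr_ge0 => i _; exact: sqr_ge0.
set X : R := (num_changes G G')%:R.
set A : R := (count_pairs G setT)%:R in h2 *.
set I : R := (count_pairs (monochromatic G c) setT)%:R.
rewrite natrD -/A -/I in h1.
have Qn : Q = (\sum_(i < r) #|[set v | c v == i]| ^ 2)%N%:R.
  by rewrite natr_sum; apply: eq_bigr => i _; rewrite natrX.
(* An ordered pair of equal colours is a monochromatic arc or not an arc. *)
have QI : Q <= I + N ^+ 2 - A.
  rewrite lerBrDr Qn /I /A /N expr2 -natrM -!natrD ler_nat -Vn -sum_sq_classes.
  rewrite !count_pairsT -sum_nat_pairs1 -!sum2D; apply: leq_sum => u _; apply: leq_sum => v _.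
  by rewrite /monochromatic val_eqE; case: (G u v); case: (c u == c v).
have large i : s i - N / r%:R <= eta * N.
  have h : (s i - N / r%:R) ^+ 2 <= (eta * N) ^+ 2.
    apply: (@le_trans _ _ (\sum_i (s i - N / r%:R) ^+ 2)).
      rewrite (bigD1 i) //= lerDl; apply: sumr_ge0 => j _; exact: sqr_ge0.
    rewrite var exprMn; lra.
  have p0 : 0 <= eta * N by rewrite mulr_ge0 // ltW.
  by rewrite leNgt; apply/negP => lt; move: h; rewrite leNgt ltrXn2r.
have part i : (#|[set v | c v == i]| - n %/ r)%N%:R <= eta * N + 1.
  have [le|lt] := leqP #|[set v | c v == i]| (n %/ r).
    have /eqP -> : (#|[set v | c v == i]| - n %/ r == 0)%N by rewrite subn_eq0.
    by rewrite addr_ge0 // mulr_ge0 // ltW.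
  rewrite natrB ?(ltnW lt) // -/(s i).
  have := large i.
  have : N / r%:R <= (n %/ r)%N%:R + 1.
    by rewrite ler_pdivrMr // natr1 /N -natrM ler_nat ltnW // ltn_ceil.
  lra.
have parts : (\sum_(i < r) (#|[set v | c v == i]| - n %/ r))%N%:R <= r%:R * (eta * N + 1).
  rewrite natr_sum (le_trans (ler_sum _ (fun i _ => part i))) //.
  by rewrite sumr_const card_ord mulr_natl.
move: ch; rewrite -(ler_nat R) !natrD !natrM -/X -/A -/I -Qn -/N => ch.
have {}parts := ler_wpM2l (ltW N0) parts.
have e1 : eta * N ^+ 2 * (8 * r%:R) <= beta * N ^+ 2.
  by rewrite mulrAC ler_wpM2r ?sqr_ge0.
have e2 : 8 * r%:R * N <= beta * N * N by rewrite ler_wpM2r // ltW.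
have e3 : eta ^+ 2 * N ^+ 2 <= eta * N ^+ 2.
  by rewrite ler_wpM2r ?sqr_ge0 // expr2 ger_pMl.
have e4 : eta * N ^+ 2 <= eta * N ^+ 2 * r%:R.
  by rewrite ler_peMr ?ler1n // mulr_ge0 ?sqr_ge0 // ltW.
rewrite -/X; lra.
Qed.

(** * Combining the weighted bounds *)

Theorem theorem4p1 (R : realType) (r t : nat) (a : R)
  (hr : (2 <= r)%N) (ht : (1 <= t)%N) (ha : 3 / 2 < a <= 2) :
  forall beta : R, 0 < beta ->
  exists (gamma : R) (n0 : nat), 0 < gamma /\
    forall n : nat, (n0 <= n)%N ->
    forall (V : finType) (G : digraph V), #|V| = n ->
      free_of (blowup (trans_tournament r.+1) t) G ->
      weighted_size a G >= a * (turan_number r n)%:R - gamma * n%:R ^+ 2 ->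
      exists G' : digraph V,
        isomorphic (DT r n) G' /\
        (num_changes G G')%:R <= beta * n%:R ^+ 2.
Proof.
move=> beta b0; case: r hr => // r _; have r0 : (0 < r.+1)%N by [].
have [e e0 [n1 hn1]] := @colouring_close_to_DT R r.+1 beta r0 b0.
have {ha}[a1 a2] := andP ha.
(* The weight of e_2 in the convex combination: 2 e_a = (2 - a)(4 f1 + 6 f2) + 2 l (f1 + 2 f2). *)
pose l : R := 2 * a - 3.
have l0 : 0 < l by rewrite /l; lra.
have le0 : 0 < l * e by rewrite mulr_gt0.
have [d1 d1_gt0 hd1] := @few_trans_colouring R r e e0.
have [d2 d2_gt0 hd2] := @few_trans_pair_weight R r.+1 (l * e) r0 le0.
have d0 : 0 < Num.min d1 d2 by rewrite lt_min d1_gt0.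
have [n2 hn2] := @free_of_few_trans R r.+2 t _ d0.
(* The lower bound for [l] times the number of arcs may lose [l * e * N ^+ 2]: a quarter goes to
   [gamma], at most a quarter to the pair weight bound as [2 - a < 1 / 2], and half to the linear
   loss in [turan_number_ge], by the choice of threshold. *)
exists (l * e / 4), (maxn (maxn n1 n2) (Num.bound (2 / (l * e))).+1); split.
  by rewrite divr_gt0.
move=> n; rewrite !geq_max => /andP[/andP[nn1 nn2] nb] V G Vn free; rewrite /weighted_size => size.
have few := hn2 V G ltac:(by rewrite Vn) free.
rewrite Vn in few; set N : R := n%:R in few size *.
have N0 : 0 < N by rewrite ltr0n; apply: leq_ltn_trans nb.
have fewW d : Num.min d1 d2 <= d -> (num_trans G r.+2 [set: V])%:R <= d * N ^+ r.+2.
  by move=> h; apply: le_trans few _; rewrite ler_wpM2r // exprn_ge0 // ltW.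
have [c cr col] := hd1 V G setT ltac:(by rewrite Vn; apply: fewW; rewrite ge_min lexx).
have pw := hd2 V G (arc_irr G) ltac:(by rewrite Vn; apply: fewW; rewrite ge_min lexx orbT).
rewrite cardsT Vn -/N in col; rewrite Vn sum_pair_weight natrD !natrM -/N in pw.
have hN : 2 <= l * e * N.
  have /archi_boundP h : 0 <= 2 / (l * e) by rewrite divr_ge0 // ltW.
  by rewrite [leRHS]mulrC -ler_pdivrMr //; apply: ltW (lt_trans h _); rewrite ltr_nat.
apply: (hn1 n nn1 V G (fun v => Ordinal (cr v)) Vn); first exact: col.
rewrite -/N sum_arcs natrD natrM.
have := turan_number_ge R n r0; rewrite -/N.
move: size pw; move: ((f1 G)%:R) ((f2 G)%:R) ((turan_number _ _)%:R) => x1 x2 T.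
set q : R := 1 - _^-1; clearbody q => size pw hT.
have hT' : a * (q * N ^+ 2 - N) <= a * (2 * T) by rewrite ler_wpM2l //; lra.
have h2 : 2 * N <= l * e * N * N by rewrite ler_wpM2r // ltW.
have h3 : (2 - a) * (4 * x1 + 6 * x2) <= (2 - a) * ((3 * q + l * e) * N ^+ 2).
  by rewrite ler_wpM2l //; lra.
have l1 : l <= 1 by rewrite /l; lra.
have h4 : l * (l * e * N ^+ 2) <= l * e * N ^+ 2.
  by rewrite ger_pMl // mulr_gt0 // exprn_gt0.
have h5 : a * N <= 2 * N by rewrite ler_wpM2r // ltW.
rewrite -(ler_pM2l l0).
have h6 : 0 <= l * (l * e * N ^+ 2) by rewrite !mulr_ge0 ?sqr_ge0 // ltW.
rewrite /l in h2 h3 h4 h6 size *.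
nra.
Qed.
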